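(* Let $X$ be a complex Banach space and let $T\in\mathcal{B}(X)$ be a quasinilpotent operator. Then $1\in\Lambda(T)$; that is, there exists a non-zero vector $x\in X$ such that $k_T(x)=1$.
   Context: $\mathcal{B}(X)$ is the set of bounded linear operators on $X$. An operator $T\in\mathcal{B}(X)$ is quasinilpotent if its spectrum is $\sigma(T)=\{0\}$. For a quasinilpotent $T\in\mathcal{B}(X)$ and $x\in X\setminus\{0\}$, put $$k_T(x)=\limsup_{\lambda\to 0}\frac{\ln\|(\lambda-T)^{-1}x\|}{\ln\|(\lambda-T)^{-1}\|},$$ where $\lambda$ ranges over non-zero complex numbers. The power set of $T$ is $\Lambda(T)=\{k_T(x):x\in X,\ x\neq 0\}$. *)

(* Defs.v *)
From HB Require Import structures.
From mathcomp Require Import all_boot all_order all_algebra.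
From mathcomp Require Import all_classical all_reals all_analysis.
From mathcomp.real_closed Require Import complex.

Set Implicit Arguments.
Unset Strict Implicit.
Unset Printing Implicit Defensive.

Import Order.TTheory GRing.Theory Num.Theory.
Import numFieldNormedType.Exports.
Local Open Scope classical_set_scope.
Local Open Scope ring_scope.
Local Open Scope complex_scope.

Section Operators.
Context {R : realType} {X : completeNormedModType R[i]}.
Implicit Types (T S : X -> X) (l : R[i]) (x : X).

(* [`|x|] lives in the scalar field [R[i]]; it is a nonnegative real there, so
   its real part is the usual real-valued norm. *)
Definition rnorm x : R := complex.Re `|x|.

Definition boundedOp : set (X -> X) :=
  [set T | linear T /\ exists M : R, forall x, rnorm (T x) <= M * rnorm x].

Definition opnorm T : R := sup [set rnorm (T x) | x in [set x | rnorm x <= 1]].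

Definition inverseOp T : set (X -> X) :=
  [set S | [/\ boundedOp S, cancel T S & cancel S T]].

Definition spectrum T : set R[i] :=
  [set l | ~ (inverseOp (fun x => l *: x - T x) !=set0)].

Definition quasinilpotent T := spectrum T = [set 0].

(* The inverse in the algebra of bounded operators, which is unique when it
   exists; the zero operator is a junk value for [l] in the spectrum. *)
Definition resolvent T l : X -> X :=
  xget (fun=> 0) (inverseOp (fun x => l *: x - T x)).

(* The filter [0^'] is taken in [R[i]^o] because [R[i]] itself carries no
   canonical topology; it is the punctured neighborhood filter for the
   modulus. *)
Definition local_exponent T x : \bar R :=
  limf_esup (fun l : R[i]^o =>
    (ln (rnorm (resolvent T l x)) / ln (opnorm (resolvent T l)))%:E)
    (0 : R[i]^o)^'.

Definition power_set T : set (\bar R) :=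
  [set local_exponent T x | x in [set x | x != 0]].

End Operators.

(* Main.v *)
Require Import Defs.
From mathcomp Require Import all_boot all_order all_algebra.
From mathcomp Require Import all_classical all_reals all_analysis.
From mathcomp Require Import ring lra.
From mathcomp.real_closed Require Import complex.

Local Open Scope classical_set_scope.
Local Open Scope ring_scope.
Local Open Scope complex_scope.

(** Write [R(l)] for the resolvent of [T] and [N(l)] for its norm.

The engine is that [N(l)] blows up as [l] tends to 0: if [|l| N(l) < 1] for
some nonzero [l], then [- T = (l - T) (1 - l R(l))] would be invertible by a
Neumann series, although 0 lies in the spectrum; hence [N(l) >= 1 / |l|]
([resolvent_opnorm_ge]).

Since [|R(l) x| <= N(l) |x|], the quotient of logarithms is at most
[1 + ln |x| / ln N(l)], and the error term vanishes in the limit; so the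
exponent of every nonzero vector is at most 1 ([local_exponent_le1]).

For a vector whose exponent is at least 1, a gliding hump in the style of
Sokal's proof of the uniform boundedness principle gives, for any sequence of
nonzero bounded operators [S_n], one vector [x] with
[|S_n x| >= |S_n| / (6 * 3^n)] for all [n] ([condensation]). The loss
[6 * 3^n] does not depend on the operators, so it disappears at logarithmic
scale once the norms grow fast enough: with [S_n = R(l_n)], [l_n] tending to 0
and [N(l_n) >= (6 * 3^n)^(n+1)], the quotient at [l_n] is at least
[1 - 1 / (n+1)] ([exists_local_exponent_ge1]). *)

Section VectorOfExponentOne.
Set Implicit Arguments.
Unset Strict Implicit.
Unset Printing Implicit Defensive.
Import Order.TTheory GRing.Theory Num.Theory.
Import numFieldNormedType.Exports.

(** * Real-valued norms *)

Section Norms.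
Context {R : realType} {X : completeNormedModType R[i]}.
Implicit Types (S T L : X -> X) (x y : X) (l : R[i]).

Definition modulus l : R := complex.Re `|l|.

Lemma normE x : `|x| = (rnorm x)%:C.
Proof.
have := normr_ge0 x; rewrite /rnorm lecE /= => /andP[/eqP H _].
by case: `|x| H => a b /= ->.
Qed.

Lemma rnorm_ge0 x : 0 <= rnorm x.
Proof. by have := normr_ge0 x; rewrite lecE /= => /andP[]. Qed.

Lemma rnorm0 : rnorm (0 : X) = 0.
Proof. by rewrite /rnorm normr0. Qed.

Lemma rnorm_gt0 x : x != 0 -> 0 < rnorm x.
Proof.
move=> x0; rewrite lt_def rnorm_ge0 andbT; apply: contra x0 => /eqP H.
by rewrite -normr_eq0 normE H.
Qed.

Lemma rnormN x : rnorm (- x) = rnorm x.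
Proof. by rewrite /rnorm normrN. Qed.

Lemma rnormB x y : rnorm (x - y) = rnorm (y - x).
Proof. by rewrite -rnormN opprB. Qed.

Lemma rnormMn x n : rnorm (x *+ n) = rnorm x *+ n.
Proof. by rewrite /rnorm normrMn raddfMn. Qed.

Lemma rnormD x y : rnorm (x + y) <= rnorm x + rnorm y.
Proof. by rewrite -lecR rmorphD /= -!normE ler_normD. Qed.

Lemma modulus_norm l : `|l| = (modulus l)%:C.
Proof. by rewrite /modulus normc_def. Qed.

Lemma rnormZ l x : rnorm (l *: x) = modulus l * rnorm x.
Proof.
suff : (rnorm (l *: x))%:C = (modulus l * rnorm x)%:C by case.
by rewrite rmorphM /= -!normE normrZ modulus_norm.
Qed.

Lemma modulus_ge0 l : 0 <= modulus l.
Proof. by have := normr_ge0 l; rewrite modulus_norm lecR. Qed.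

Lemma modulus_gt0 l : l != 0 -> 0 < modulus l.
Proof. by rewrite -normr_gt0 modulus_norm ltcR. Qed.

Lemma modulus_real (r : R) : 0 <= r -> modulus r%:C = r.
Proof. by move=> r0; rewrite /modulus ger0_norm ?lecR. Qed.

(** * Completeness *)

(** Completeness in the only form used below, with an explicit rate of
convergence: it drives both the Neumann series and the gliding hump. *)
Lemma geometric_steps_limit (u : nat -> X) (c q : R) :
  0 <= q -> q < 1 ->
  (forall n, rnorm (u n.+1 - u n) <= c * q ^+ n) ->
  exists x, forall n, rnorm (x - u n) <= c * q ^+ n / (1 - q).
Proof.
move=> q0 q1 hu.
have d0 : 0 < 1 - q by rewrite subr_gt0.
have c0 : 0 <= c by have := le_trans (rnorm_ge0 _) (hu 0%N); rewrite expr0 mulr1.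
have tail n k : rnorm (u (n + k)%N - u n) <= c * q ^+ n * (1 - q ^+ k) / (1 - q).
  elim: k => [|k IH]; first by rewrite addn0 subrr rnorm0 expr0 subrr mulr0 mul0r.
  rewrite addnS -(subrKA (u (n + k)%N)).
  apply: (le_trans (rnormD _ _)).
  apply: (le_trans (lerD (hu _) IH)).
  rewrite exprD exprS le_eqVlt; apply/orP; left; apply/eqP.
  by field; rewrite gt_eqF.
have tail' n k : rnorm (u (n + k)%N - u n) <= c * q ^+ n / (1 - q).
  apply: (le_trans (tail n k)); rewrite ler_pM2r ?invr_gt0//.
  rewrite -[leRHS]mulr1 ler_wpM2l ?mulr_ge0 ?exprn_ge0//.
  by rewrite gerBl exprn_ge0.
have small (e : R) : 0 < e -> exists N, c * q ^+ N / (1 - q) < e.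
  move=> e0.
  have := @cvg_geometric R (c / (1 - q)) q; rewrite ger0_norm // => /(_ q1).
  move=> /cvgrPdist_lt /(_ _ e0) [N _ /(_ N (leqnn N))] /=.
  rewrite sub0r normrN mulrAC => H; exists N; apply: le_lt_trans H; exact: ler_norm.
have /cauchy_cvgP cu : cauchy (u @ \oo).
  apply: cauchy_exP => e e0.
  have e0R : 0 < complex.Re e by move: e0; rewrite ltcE => /andP[].
  have [N hN] := small _ e0R.
  exists (u N); exists N => // n /= Nn.
  rewrite -ball_normE /= normE.
  move: (e0); rewrite !ltcE /= => /andP[-> _] /=.
  apply: le_lt_trans hN; rewrite rnormB -(subnKC Nn); exact: tail'.
exists (lim (u @ \oo)) => n.
apply/ler_addgt0Pr => e e0.
have e0C : 0 < e%:C by rewrite ltcR.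
move/cvgrPdist_lt : cu => /(_ _ e0C) [N _ hN].
have := hN (n + N)%N (leq_addl _ _) => /=.
rewrite normE ltcR => H.
rewrite -(subrKA (u (n + N)%N)) addrC.
apply: (le_trans (rnormD _ _)); apply: lerD; [exact: tail'|exact: ltW].
Qed.

(** * Bounded operators *)
Lemma linearB_of L : linear L -> forall x y, L (x - y) = L x - L y.
Proof. by move=> h x y; rewrite -[- y]scaleN1r addrC h scaleN1r addrC. Qed.

Lemma linearD_of L : linear L -> forall x y, L (x + y) = L x + L y.
Proof. by move=> h x y; rewrite -[x]scale1r h !scale1r. Qed.

Lemma linear0_of L : linear L -> L 0 = 0.
Proof. by move=> h; have := linearB_of h 0 0; rewrite !subrr. Qed.

Lemma linearZ_of L : linear L -> forall l x, L (l *: x) = l *: L x.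
Proof. by move=> h l x; rewrite -[l *: x]addr0 h linear0_of// addr0. Qed.

Lemma unit_ball_bound S : boundedOp S ->
  has_sup [set rnorm (S x) | x in [set x | rnorm x <= 1]].
Proof.
move=> [lS [M hM]]; split.
  by exists (rnorm (S 0)), 0 => //=; rewrite rnorm0.
exists `|M| => _ [x /= x1 <-].
apply: (le_trans (hM x)); apply: (@le_trans _ _ (`|M| * rnorm x)).
  by rewrite ler_wpM2r ?rnorm_ge0 ?ler_norm.
by rewrite -[leRHS]mulr1 ler_wpM2l.
Qed.

Lemma rnorm_le_opnorm S x : boundedOp S -> rnorm (S x) <= opnorm S * rnorm x.
Proof.
move=> bS; have [->|x0] := eqVneq x 0.
  by rewrite linear0_of ?rnorm0 ?mulr0//; case: bS.
have nx := rnorm_gt0 x0.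
have lx : 0 <= (rnorm x)^-1 by rewrite invr_ge0 ltW.
rewrite -ler_pdivrMr// mulrC -[X in X * _]modulus_real//.
rewrite -rnormZ -linearZ_of; last by case: bS.
apply: ub_le_sup; first by case: (unit_ball_bound bS).
exists ((rnorm x)^-1%:C *: x) => //=.
by rewrite rnormZ modulus_real// mulVf// gt_eqF.
Qed.

Lemma opnorm_approx S (a : R) : boundedOp S -> a < opnorm S ->
  exists2 x, rnorm x <= 1 & a < rnorm (S x).
Proof.
move=> bS; have [h _] := unit_ball_bound bS.
by move=> /(sup_gt h) [_ [x x1 <-] ax]; exists x.
Qed.

Lemma opnorm_ge0 S : boundedOp S -> 0 <= opnorm S.
Proof.
move=> bS; apply: ub_le_sup; first by case: (unit_ball_bound bS).
by exists 0; rewrite /= ?rnorm0// linear0_of ?rnorm0//; case: bS.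
Qed.

(** The lower bound gives both injectivity, so that a right inverse obtained by
choice is two-sided and linear, and the bound [C] on that inverse. *)
Lemma inverse_of_bijective L (C : R) : linear L ->
  (forall y, exists x, L x = y) -> (forall x, rnorm x <= C * rnorm (L x)) ->
  inverseOp L !=set0.
Proof.
move=> lL /choice[S LS] hC; exists S.
have inj x y : L x = L y -> x = y.
  move=> e; apply/eqP; rewrite -subr_eq0; apply/negP => /negP /rnorm_gt0.
  rewrite ltNge; apply/negP; rewrite negbK.
  by apply: (le_trans (hC _)); rewrite linearB_of// e subrr rnorm0 mulr0.
split; last exact: LS.
- split; first by move=> l x y; apply: inj; rewrite lL !LS.
  by exists C => x; rewrite -{2}(LS x).
- by move=> x; apply: inj; rewrite LS.
Qed.

(** * Condensation of singularities *)

(** Any ball of radius [r], wherever its centre, contains a vector on which [S]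
is almost as large as [r |S|]: if [w] of norm at most [r] nearly attains
[r |S|], then [2 S w] is the difference of [S (x + w)] and [S (x - w)], so one
of the two has norm at least [|S w|]. *)
Lemma large_in_ball S x (r a : R) : boundedOp S -> 0 < r -> a < opnorm S ->
  exists2 y, rnorm (y - x) <= r & a * r <= rnorm (S y).
Proof.
move=> bS r0 /(opnorm_approx bS) [z z1 az].
have lS : linear S by case: bS.
have r0' := ltW r0.
pose w := r%:C *: z.
have w1 : rnorm w <= r.
  by rewrite rnormZ modulus_real// -[leRHS]mulr1 ler_wpM2l.
have Sw : a * r < rnorm (S w).
  by rewrite linearZ_of// rnormZ modulus_real// mulrC ltr_pM2l.
have H : rnorm (S w) *+ 2 <= rnorm (S (x + w)) + rnorm (S (x - w)).
  have -> : rnorm (S w) *+ 2 = rnorm (S (x + w) - S (x - w)).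
    rewrite -linearB_of// opprB addrCA [x + w]addrC addrK linearD_of//.
    by rewrite -mulr2n rnormMn.
  by apply: (le_trans (rnormD _ _)); rewrite rnormN.
have [h|h] := leP (a * r) (rnorm (S (x + w))).
  by exists (x + w); rewrite // addrC addKr.
exists (x - w); first by rewrite addrC addKr rnormN.
move: H; rewrite mulr2n; lra.
Qed.

(** Successive corrections [u_(n+1) - u_n] of norm at most [3^-n] make
[|S_n u_(n+1)| >= 2/3 * 3^-n |S_n|]. All later corrections add up to at most
[3^-n / 2], which costs [S_n] at most [1/2 * 3^-n |S_n|]; the remainder
[2/3 - 1/2] is the constant [1/6]. *)
Lemma condensation (S : nat -> X -> X) :
  (forall n, boundedOp (S n)) -> (forall n, 0 < opnorm (S n)) ->
  exists x, forall n, opnorm (S n) / (6 * 3 ^+ n) <= rnorm (S n x).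
Proof.
move=> bS S0.
have r0 n : 0 < (3 ^+ n : R)^-1 by rewrite invr_gt0 exprn_gt0.
have step n x : exists y, rnorm (y - x) <= (3 ^+ n)^-1 /\
    2 / 3 * opnorm (S n) / 3 ^+ n <= rnorm (S n y).
  have [|||y h1 h2] := @large_in_ball (S n) x (3 ^+ n)^-1 (2 / 3 * opnorm (S n)).
  - exact: bS.
  - exact: r0.
  - by have := S0 n; lra.
  - by exists y.
pose f n x := projT1 (cid (step n x)).
have fP n x := projT2 (cid (step n x)).
pose u := fix u n := if n is m.+1 then f m (u m) else 0.
have [|||x hx] := @geometric_steps_limit u 1 3^-1.
- by [].
- lra.
- by move=> n; rewrite mul1r exprVn; have [] := fP n (u n).
exists x => n.
have [_ h] := fP n (u n).
have hn := hx n.+1.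
have b := rnorm_le_opnorm (x - u n.+1) (bS n).
have lS : linear (S n) by case: (bS n).
have t : rnorm (S n (u n.+1)) <= rnorm (S n x) + rnorm (S n (x - u n.+1)).
  have -> : S n (u n.+1) = S n x - S n (x - u n.+1).
    by rewrite linearB_of// subKr.
  by apply: (le_trans (rnormD _ _)); rewrite rnormN.
have hn' : rnorm (x - u n.+1) <= (3 ^+ n)^-1 / 2.
  apply: (le_trans hn); rewrite exprVn exprS le_eqVlt; apply/orP; left.
  apply/eqP; field; rewrite expf_neq0//.
have := ler_wpM2l (ltW (S0 n)) hn' => hm.
rewrite invfM.
set p := (3 ^+ n)^-1 in h hm *.
have : 2 / 3 * opnorm (S n) * p <= rnorm (S n (u n.+1)) by [].
have := S0 n.
move: h hm t b; set N := opnorm _; set A := rnorm _; set B := rnorm _; set D := rnorm _.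
have -> : N * (p / 2) = (N * p) / 2 by ring.
have -> : N * (6^-1 * p) = (N * p) / 6 by field.
have -> : 2 / 3 * N * p = 2 / 3 * (N * p) by ring.
set P := N * p. lra.
Qed.

(** * Growth of the resolvent *)

(** The Neumann series, run as the iteration [u_(n+1) = y + A u_n]. *)
Lemma sub_contraction_onto A (q : R) : linear A -> 0 <= q -> q < 1 ->
  (forall x, rnorm (A x) <= q * rnorm x) -> forall y, exists x, x - A x = y.
Proof.
move=> lA q0 q1 hA y.
pose u := fix u n := if n is m.+1 then y + A (u m) else 0.
have hu n : rnorm (u n.+1 - u n) <= rnorm y * q ^+ n.
  elim: n => [|n IH]; first by rewrite /= linear0_of// addr0 subr0 mulr1.
  have -> : u n.+2 - u n.+1 = A (u n.+1 - u n).
    rewrite linearB_of//.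
    have E m : u m.+1 = y + A (u m) by [].
    by rewrite E [X in _ - X]E opprD addrACA subrr add0r.
  by apply: (le_trans (hA _)); rewrite exprS mulrCA ler_wpM2l.
have [x hx] := geometric_steps_limit q0 q1 hu.
exists x; apply/eqP; rewrite -subr_eq0; apply/negP => /negP /rnorm_gt0 r0.
pose K := rnorm y / (1 - q) * (q + q).
have bound n : rnorm (x - A x - y) <= geometric K q n.
  have -> : x - A x - y = (x - u n.+1) - A (x - u n).
    have -> : u n.+1 = y + A (u n) by [].
    by rewrite linearB_of// opprB opprD !addrA subrK addrAC.
  apply: (le_trans (rnormD _ _)); rewrite rnormN.
  apply: (le_trans (lerD (hx _) (hA _))).
  apply: (le_trans (lerD (lexx _) (ler_wpM2l q0 (hx n)))).
  rewrite /geometric /= /K exprS le_eqVlt; apply/orP; left; apply/eqP.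
  by field; rewrite gt_eqF// subr_gt0.
have := @cvg_geometric R K q; rewrite ger0_norm // => /(_ q1).
move=> /cvgrPdist_lt /(_ _ r0) [n _ /(_ n (leqnn n))].
rewrite sub0r normrN => H.
by have := lt_le_trans H (bound n); rewrite ltNge ler_norm.
Qed.

Section Resolvent.
Variables (T : X -> X).
Hypotheses (bT : boundedOp T) (qT : quasinilpotent T).
Local Notation Res := (resolvent T).

Lemma resolventP l : l != 0 -> inverseOp (fun x => l *: x - T x) (Res l).
Proof.
move=> l0; apply: xgetPex.
apply: contrapT => h.
have : spectrum T l by [].
by rewrite qT /= => /eqP; rewrite (negbTE l0).
Qed.

Lemma resolvent_bounded l : l != 0 -> boundedOp (Res l).
Proof. by case/resolventP. Qed.

Lemma resolvent_gt0 l x : l != 0 -> x != 0 -> 0 < rnorm (Res l x).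
Proof.
move=> l0 x0; apply: rnorm_gt0; apply: contra x0 => /eqP h.
have [_ _ /(_ x)] := resolventP l0.
rewrite h scaler0 linear0_of; last by case: bT.
by rewrite subr0 => <-.
Qed.

(** The distance from [l] to the spectrum is [|l|]; were the norm of the
resolvent below its inverse, [1 - l R(l)] would be invertible and with it
[- T = (l - T) (1 - l R(l))]. *)
Lemma resolvent_opnorm_ge l : l != 0 -> 1 <= modulus l * opnorm (Res l).
Proof.
move=> l0; rewrite leNgt; apply/negP => q1.
have [bR RK KR] := resolventP l0.
have [lR _] := bR.
have [lT _] := bT.
set q := modulus l * _ in q1.
have q0 : 0 <= q by rewrite mulr_ge0 ?modulus_ge0 ?opnorm_ge0.
have : spectrum T 0 by rewrite qT.
apply.
pose A x := l *: Res l x.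
have lA : linear A.
  by move=> a x y; rewrite /A lR scalerDr !scalerA mulrC.
have hA x : rnorm (A x) <= q * rnorm x.
  by rewrite rnormZ -mulrA ler_wpM2l ?modulus_ge0 ?rnorm_le_opnorm.
have key x : x - A x = Res l (0 *: x - T x).
  rewrite scale0r sub0r -{1}(RK x) /A -linearZ_of// -linearB_of//.
  by rewrite addrAC subrr sub0r.
apply: (@inverse_of_bijective _ (opnorm (Res l) / (1 - q))).
- by move=> a x y; rewrite !scale0r !sub0r lT opprD scalerN.
- move=> y; have [x hx] := sub_contraction_onto lA q0 q1 hA (Res l y).
  by exists x; rewrite -(KR (0 *: x - T x)) -key hx KR.
- move=> x; rewrite mulrAC ler_pdivlMr ?subr_gt0//.
  apply: le_trans (rnorm_le_opnorm _ bR); rewrite -key.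
  have := hA x; have := rnormD (x - A x) (A x); rewrite subrK; lra.
Qed.

Lemma resolvent_blowup (M : R) : exists2 d : R, 0 < d &
  forall l, l != 0 -> modulus l < d -> M <= opnorm (Res l).
Proof.
have M0 : 0 < `|M| + 1 by rewrite ltr_wpDl.
exists (`|M| + 1)^-1 => [|l l0 ld]; first by rewrite invr_gt0.
have h := resolvent_opnorm_ge l0.
apply: (@le_trans _ _ (`|M| + 1)).
  by apply: (le_trans (ler_norm M)); rewrite lerDl.
rewrite -[leLHS]mul1r -ler_pdivlMr//.
apply: (le_trans h); rewrite mulrC ler_wpM2l//; last exact: ltW.
exact/opnorm_ge0/resolvent_bounded.
Qed.

(** * The exponents *)

Lemma dnbhs0P (V : set R[i]) : (0 : R[i]^o)^' V <->
  exists2 d : R, 0 < d & forall l, l != 0 -> modulus l < d -> V l.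
Proof.
rewrite /dnbhs /within /=; split.
- move=> /nbhs_ballP[e /= e0 h].
  move: (e0); rewrite ltcE => /andP[/eqP ei er].
  exists (complex.Re e) => // l l0 ld; apply: h => //.
  rewrite -ball_normE /= sub0r normrN modulus_norm.
  by rewrite ltcE ei eqxx.
- move=> [d d0 h]; apply/nbhs_ballP; exists d%:C => /=; first by rewrite ltcR.
  move=> l; rewrite -ball_normE /= sub0r normrN modulus_norm ltcR => ld l0.
  exact: h.
Qed.

Lemma local_exponent_le1 x : x != 0 -> (local_exponent T x <= 1%E)%E.
Proof.
move=> x0; apply/lee_addgt0Pr => e e0.
(* [|ln |x|| <= e * ln N] makes the error term at most [e]; the summand 1 keeps
   [ln N] positive, also when [ln |x| = 0]. *)
pose M := expR (`|ln (rnorm x)| / e + 1).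
have [d d0 hd] := resolvent_blowup M.
apply: ge_ereal_inf.
exists (ereal_sup ((fun l => (ln (rnorm (Res l x)) / ln (opnorm (Res l)))%:E)
   @` [set l | l != 0 /\ modulus l < d])).
  by exists [set l | l != 0 /\ modulus l < d] => //; apply/dnbhs0P; exists d.
apply: ge_ereal_sup => _ [l [l0 ld] <-].
rewrite -EFinD lee_fin.
have MN := hd l l0 ld.
have N0 : 0 < opnorm (Res l) by apply: lt_le_trans MN; exact: expR_gt0.
have lnN : `|ln (rnorm x)| / e + 1 <= ln (opnorm (Res l)).
  by rewrite -[leLHS]expRK ler_ln ?posrE ?expR_gt0.
have c0 : 0 <= `|ln (rnorm x)| / e by rewrite divr_ge0// ltW.
have lnN0 : 0 < ln (opnorm (Res l)) by lra.
rewrite ler_pdivrMr// mulrDl mul1r.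
apply: (@le_trans _ _ (ln (opnorm (Res l) * rnorm x))).
  rewrite ler_ln ?posrE ?mulr_gt0 ?resolvent_gt0 ?rnorm_gt0//.
  exact/rnorm_le_opnorm/resolvent_bounded.
rewrite lnM ?posrE ?rnorm_gt0// lerD2l.
apply: (le_trans (ler_norm _)).
rewrite mulrC -ler_pdivrMr//; lra.
Qed.

(** The sequence [l] is chosen so that the factor lost in [condensation] is at
most the [(n+1)]-st root of the norm of the resolvent at [l n]. *)
Lemma exists_local_exponent_ge1 : exists2 x, x != 0 & (1%E <= local_exponent T x)%E.
Proof.
pose w n : R := 6 * 3 ^+ n.
have w1 n : 1 < w n.
  have : 1 <= (3 : R) ^+ n by rewrite exprn_ege1// ler1n.
  rewrite /w; lra.
have w0 n : 0 < w n by apply: lt_trans (w1 n).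
have /choice[l hl] (n : nat) : exists l : R[i],
    [/\ l != 0, modulus l < n.+1%:R^-1 & w n ^+ n.+1 <= opnorm (Res l)].
  have [d d0 hd] := resolvent_blowup (w n ^+ n.+1).
  (* A real point serves: only the modulus matters. *)
  pose m := Num.min d n.+1%:R^-1 / 2.
  have m0 : 0 < m by rewrite divr_gt0// lt_min d0 invr_gt0 ltr0n.
  have mm : m < Num.min d n.+1%:R^-1.
    rewrite /m in m0 *; lra.
  have mC : m%:C != 0 by rewrite gt_eqF// ltcR.
  move: mm; rewrite lt_min => /andP[md mn].
  exists m%:C; split => //; first by rewrite modulus_real// ltW.
  by apply: hd => //; rewrite modulus_real// ltW.
have N0 n : 0 < opnorm (Res (l n)).
  by have [_ _] := hl n; apply: lt_le_trans; rewrite exprn_gt0.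
have [n|n|x hx] := @condensation (fun n => Res (l n)).
- by have [/resolvent_bounded] := hl n.
- exact: N0.
have r0 n : 0 < rnorm (Res (l n) x).
  by apply: lt_le_trans (hx n); rewrite divr_gt0.
exists x.
  apply/eqP => x0; have := r0 0%N; rewrite x0 linear0_of ?rnorm0 ?ltxx//.
  by have [/resolvent_bounded[]] := hl 0%N.
apply: le_ereal_inf_tmp => _ [V /dnbhs0P[d d0 hV] <-].
apply/lee_subgt0Pr => e e0.
(* One index [n] with [1 / (n+1)] below both [d] and [e] puts [l n] in [V] and
   brings the quotient there above [1 - e]. *)
have de : 0 < Num.min d e by rewrite lt_min d0.
have [n _ /(_ n (leqnn n)) /=] := near_infty_natSinv_lt (PosNum de).
rewrite lt_min => /andP[nd ne].
have [ln0 lnn hN] := hl n.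
have lnw : 0 < ln (w n) by rewrite ln_gt0.
have lnN : ln (w n) *+ n.+1 <= ln (opnorm (Res (l n))).
  by rewrite -lnXn// ler_ln ?posrE ?exprn_gt0.
have lnN0 : 0 < ln (opnorm (Res (l n))).
  by apply: lt_le_trans lnN; rewrite pmulrn_lgt0.
apply: le_trans (ereal_sup_ubound _); last first.
  by exists (l n); [apply: hV => //; exact: lt_trans nd | reflexivity].
rewrite -EFinD lee_fin ler_pdivlMr// mulrBl mul1r.
apply: (@le_trans _ _ (ln (opnorm (Res (l n)) / w n))); last first.
  by rewrite ler_ln ?posrE ?divr_gt0//; exact: hx.
rewrite ln_div ?posrE// lerD2l lerN2.
apply: (@le_trans _ _ (n.+1%:R^-1 * ln (opnorm (Res (l n))))).
  by rewrite mulrC ler_pdivlMr ?ltr0n// mulr_natr.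
by rewrite ler_wpM2r// ltW.
Qed.

End Resolvent.
End Norms.
End VectorOfExponentOne.

Theorem theorem1p4 (R : realType) (X : completeNormedModType R[i])
  (T : X -> X) (hT : boundedOp T) (hq : quasinilpotent T) :
  power_set T 1%E.
Proof.
have [x x0 h] := exists_local_exponent_ge1 hT hq.
exists x => //; apply/eqP; rewrite Order.POrderTheory.eq_le h andbT.
exact: local_exponent_le1.
Qed.
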